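(* Let $R$ be a unital $*$-ring and let $p,q\in R$ be projectors. Suppose that $p(1-q)$ and $q(1-p)$ are $*$-cancellable. Then the following ten conditions are equivalent: (1) $1-pq\in R^\dag$; (2) $1-pqp\in R^\dag$; (3) $p-pqp\in R^\dag$; (4) $p-pq\in R^\dag$; (5) $p-qp\in R^\dag$; (6) $1-qp\in R^\dag$; (7) $1-qpq\in R^\dag$; (8) $q-qpq\in R^\dag$; (9) $q-qp\in R^\dag$; (10) $q-pq\in R^\dag$.
   Context: A unital $*$-ring is an associative (not necessarily commutative) ring $R$ with unity $1$ and an involution $a\mapsto a^*$ satisfying $(a^* )^*=a$, $(a+b)^*=a^*+b^*$, $(ab)^*=b^*a^*$. An element $a\in R$ is MP-invertible if there is $b\in R$ with $aba=a$, $bab=b$, $(ab)^*=ab$, $(ba)^*=ba$; such $b$ is unique and denoted $a^\dag$ (the Moore-Penrose inverse). $R^\dag$ is the set of MP-invertible elements of $R$. An element $p\in R$ is a projector if $p^2=p=p^*$. An element $a\in R$ is $*$-cancellable if, for all $x\in R$, $a^*ax=0$ implies $ax=0$, and $xaa^*=0$ implies $xa=0$. *)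

(* Defs.v *)
(* [pzRingType] rather than [nzRingType]: the zero ring is not excluded. *)
From HB Require Import structures.
From mathcomp Require Import all_boot all_algebra.
Set Implicit Arguments.
Unset Strict Implicit.
Unset Printing Implicit Defensive.
Import GRing.Theory.
Local Open Scope ring_scope.

Record star_ring_involution (R : pzRingType) (star : R -> R) : Prop :=
  StarRingInvolution {
    starK : forall a : R, star (star a) = a;
    starD : forall a b : R, star (a + b) = star a + star b;
    starM : forall a b : R, star (a * b) = star b * star a
  }.

Definition is_MP_inverse (R : pzRingType) (star : R -> R) (a b : R) : Prop :=
  [/\ a * b * a = a, b * a * b = b,
      star (a * b) = a * b & star (b * a) = b * a].

Definition MP_invertible (R : pzRingType) (star : R -> R) (a : R) : Prop :=
  exists b : R, is_MP_inverse star a b.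

Definition projector (R : pzRingType) (star : R -> R) (p : R) : Prop :=
  p ^+ 2 = p /\ star p = p.

Definition star_cancellable (R : pzRingType) (star : R -> R) (a : R) : Prop :=
  forall x : R,
    (star a * a * x = 0 -> a * x = 0) /\ (x * a * star a = 0 -> x * a = 0).

(* Main.v *)
(** Write x = 1 - pq, r = 1 - p and a = p(1 - q), so that a a^* = p - pqp.  Since
r x = r, the block matrix of x with respect to (p, r) is upper triangular with
diagonal blocks h = a a^* and 1.  Cancellability of a makes MP-invertibility of
a, a^* and a a^* equivalent and shows that h h^dag fixes the off-diagonal block
k of x; then [[c, -c k], [0, 1]] with c = h^dag is the Moore-Penrose inverse of
x.  Conversely, let y = x^dag.  Always y x r = r, and x y r = r by cancellability
of q(1 - p); so y is triangular too and its corner is h^dag.  The element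
1 - pqp is the case k = 0.  Exchanging p and q, and taking adjoints, gives the
rest. *)
Require Import Defs.
From HB Require Import structures.
From mathcomp Require Import all_boot all_algebra.
Set Implicit Arguments.
Unset Strict Implicit.
Unset Printing Implicit Defensive.
Import GRing.Theory.
Local Open Scope ring_scope.

Section StarRing.

Variables (R : pzRingType) (star : R -> R).
Hypothesis star_inv : star_ring_involution star.

Let sK := starK star_inv.
Let sD := starD star_inv.
Let sM := starM star_inv.

Lemma star0 : star 0 = 0.
Proof. by apply: (addrI (star 0)); rewrite -sD !addr0. Qed.

Lemma starN a : star (- a) = - star a.
Proof. by apply: (addrI (star a)); rewrite -sD !subrr star0. Qed.

Lemma starB a b : star (a - b) = star a - star b.
Proof. by rewrite sD starN. Qed.

Lemma star1 : star 1 = 1.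
Proof. by rewrite -[LHS]mul1r -{1}[1]sK -sM mul1r sK. Qed.

Lemma projectorC p : projector star p -> projector star (1 - p).
Proof.
move=> [pp sp]; split; last by rewrite starB star1 sp.
by rewrite expr2 mulrBl mul1r mulrBr mulr1 -expr2 pp subrr subr0.
Qed.

Lemma is_MP_star a b :
  is_MP_inverse star a b -> is_MP_inverse star (star a) (star b).
Proof.
move=> [aba bab sab sba].
by split; rewrite -!sM ?mulrA ?aba ?bab ?sab ?sba.
Qed.

Lemma MP_star a : MP_invertible star a -> MP_invertible star (star a).
Proof. by move=> [b /is_MP_star]; exists (star b). Qed.

(** [a * b] and [a * c] are self-adjoint and each fixes the other on its left, so taking adjoints
    identifies them; likewise [b * a] and [c * a]. *)
Lemma is_MP_unique a b c :
  is_MP_inverse star a b -> is_MP_inverse star a c -> b = c.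
Proof.
move=> [aba bab sab sba] [aca cac sac sca].
have ab_ac : a * b = a * c.
  have ac_ab : a * c * (a * b) = a * b by rewrite mulrA aca.
  by rewrite -sab -ac_ab sM sab sac mulrA aba.
have ba_ca : b * a = c * a.
  have ba_ca : b * a * (c * a) = b * a by rewrite -mulrA (mulrA a) aca.
  by rewrite -sba -ba_ca sM sba sca -mulrA (mulrA a) aba.
by rewrite -bab -mulrA ab_ac mulrA ba_ca.
Qed.

Lemma MP_mul_star a :
  MP_invertible star a -> MP_invertible star (a * star a).
Proof.
(* Both products of this witness with [a * star a] collapse to the self-adjoint [a * b]. *)
move=> [b [aba bab sab sba]]; exists (star b * b).
have e1 : a * star a * (star b * b) = a * b.
  by rewrite mulrA -(mulrA a) -sM sba mulrA aba.
have e2 : star b * b * (a * star a) = a * b.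
  by rewrite -mulrA (mulrA b) -sba -sM mulrA aba -sM sab.
split; rewrite ?e1 ?e2 ?sab //; first by rewrite mulrA aba.
by rewrite mulrA -sab -sM mulrA bab.
Qed.

(** For [h = a * star a], the equation [h * c * h = h] reads [(h * c - 1) * a * star a = 0], and
    cancellability removes [star a]. *)
Lemma cancel_mul_star a c : star_cancellable star a ->
  is_MP_inverse star (a * star a) c -> a * star a * c * a = a.
Proof.
move=> can_a [hch _ _ _].
have /(proj2 (can_a _)) : (a * star a * c - 1) * a * star a = 0.
  by rewrite -mulrA mulrBl mul1r hch subrr.
by rewrite mulrBl mul1r => /subr0_eq.
Qed.

Lemma MP_of_mul_star a : star_cancellable star a ->
  MP_invertible star (a * star a) -> MP_invertible star a.
Proof.
move=> can_a [c cP]; have hca := cancel_mul_star can_a cP.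
(* [star c] is also a Moore-Penrose inverse of the self-adjoint [a * star a]. This makes
   [star a * c * a] self-adjoint, as the witness [star a * c] requires. *)
have sc : star c = c.
  by apply: (is_MP_unique _ cP); have := is_MP_star cP; rewrite sM sK.
case: cP => hch chc shc sch; exists (star a * c); split; rewrite ?mulrA //.
  by rewrite -[in RHS]chc !mulrA.
by rewrite !sM sK sc mulrA.
Qed.

(* With respect to [1 - r] and [r], the hypothesis [r * x = r] says that [x] is
   the block matrix [[x * (1 - r), (x - 1) * r], [0, 1]]. *)
Lemma MP_corner r x y : projector star r -> r * x = r ->
  is_MP_inverse star x y -> x * y * r = r -> y * x * r = r ->
  is_MP_inverse star (x * (1 - r)) (y * (1 - r)).
Proof.
move=> [rr sr] rx [xyx yxy sxy syx] xyr yxr; rewrite expr2 in rr.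
(* The adjoint of [xyr]. With [r * x = r] it yields [r * y = r], so [y] is triangular like [x], and
   the corner products are [x * y] and [y * x] with [r] removed. *)
have rxy : r * (x * y) = r by rewrite -{1}sr -sxy -sM xyr.
have ry : r * y = r by rewrite -{1}rx -mulrA rxy.
have hc : x * (1 - r) * (y * (1 - r)) = x * y - r.
  rewrite -mulrA [(1 - r) * _]mulrA mulrBl mul1r ry mulrBr mulr1 mulrBl rr.
  by rewrite !mulrBr mulrA xyr opprB addrA subrK.
have ch : y * (1 - r) * (x * (1 - r)) = y * x - r.
  rewrite -mulrA [(1 - r) * _]mulrA mulrBl mul1r rx mulrBr mulr1 mulrBl rr.
  by rewrite !mulrBr mulrA yxr opprB addrA subrK.
split; rewrite ?hc ?ch ?starB ?sxy ?syx ?sr //.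
  by rewrite mulrA mulrBl xyx rx mulrBl [r * _]mulrBr mulr1 rr subrr subr0.
by rewrite mulrA mulrBl yxy ry mulrBl [r * _]mulrBr mulr1 rr subrr subr0.
Qed.

(** The last hypothesis cancels the off-diagonal block of [x * y], leaving the self-adjoint products
    [x * y = h * c + r] and [y * x = c * h + r]. *)
Lemma MP_triangular r x c : projector star r -> r * x = r ->
  is_MP_inverse star (x * (1 - r)) c ->
  x * (1 - r) * c * ((x - 1) * r) = (x - 1) * r ->
  MP_invertible star x.
Proof.
move=> [rr sr] rx; rewrite expr2 in rr.
set h := x * (1 - r); set k := (x - 1) * r => [[hch chc shc sch] hck].
have xE : x = h + k + r by rewrite /h /k mulrBr mulrBl mulr1 mul1r !addrA !subrK.
have rh : r * h = 0 by rewrite mulrA rx mulrBr mulr1 rr subrr.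
have hr : h * r = 0 by rewrite -mulrA mulrBl mul1r rr subrr mulr0.
have rk : r * k = 0 by rewrite mulrA mulrBr mulr1 rx subrr mul0r.
have kr : k * r = k by rewrite -mulrA rr.
(* [c = c * (h * c)], and [h * c * r] is the adjoint of [r * h * c = 0]; dually for [r * c]. *)
have cr : c * r = 0.
  by rewrite -chc -mulrA -mulrA (mulrA h) -shc -{1}sr -sM mulrA rh mul0r star0 mulr0.
have rc : r * c = 0.
  by rewrite -chc -sch -{1}sr mulrA -sM -mulrA hr mulr0 star0 mul0r.
have kc : k * c = 0 by rewrite -kr -mulrA rc mulr0.
have kk : k * k = 0 by rewrite -{1}kr -mulrA rk mulr0.
have kh : k * h = 0 by rewrite -kr -mulrA rh mulr0.
pose y := c - c * k + r.
have ry : r * y = r by rewrite !mulrDr mulrN mulrA rc mul0r subrr add0r.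
have ky : k * y = k by rewrite !mulrDr mulrN mulrA kc mul0r subrr add0r.
have hy : h * y = h * c - k by rewrite !mulrDr mulrN mulrA hck hr addr0.
have xy : x * y = h * c + r by rewrite {1}xE !mulrDl hy ky ry subrK.
have cx : c * x = c * h + c * k by rewrite {1}xE !mulrDr cr addr0.
have kx : k * x = k by rewrite {1}xE !mulrDr kh kk kr !add0r.
have yx : y * x = c * h + r by rewrite !mulrDl rx mulNr -mulrA kx cx addrK.
exists y; split; rewrite ?xy ?yx ?sD ?shc ?sch ?sr //.
  by rewrite mulrDl rx {1}xE !mulrDr hch hck -mulrA cr mulr0 addr0 -xE.
by rewrite mulrDl ry -mulrA hy mulrBr mulrA chc.
Qed.

Section Projectors.

Variables p q : R.
Hypotheses (p_proj : projector star p) (q_proj : projector star q).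

Let pp : p * p = p. Proof. by case: p_proj; rewrite expr2. Qed.
Let qq : q * q = q. Proof. by case: q_proj; rewrite expr2. Qed.
Let sp : star p = p. Proof. by case: p_proj. Qed.
Let sq : star q = q. Proof. by case: q_proj. Qed.

Lemma mul_star_projectors : p * (1 - q) * star (p * (1 - q)) = p - p * q * p.
Proof.
have [qq' sq'] := projectorC q_proj; rewrite expr2 in qq'.
by rewrite sM sp sq' mulrA -(mulrA p) qq' mulrBr mulr1 mulrBl pp.
Qed.

Lemma star_sub_mul : star (p - p * q) = p - q * p.
Proof. by rewrite starB sM sp sq. Qed.

Lemma MP_sub_mul_corner :
  star_cancellable star (p * (1 - q)) ->
  MP_invertible star (p - p * q) <-> MP_invertible star (p - p * q * p).
Proof.
move=> can; rewrite -mul_star_projectors -{1}[p]mulr1 -mulrBr.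
by split; [apply: MP_mul_star | apply: MP_of_mul_star].
Qed.

(** The free [z] covers both [1 - p * q] and, with [z = q * p], [1 - p * q * p]. *)
Lemma compl_mul_one_sub z : (1 - p) * (1 - p * z) = 1 - p.
Proof. by rewrite mulrBr mulr1 mulrBl mul1r mulrA pp subrr subr0. Qed.

Lemma one_sub_mul_corner z : (1 - p * z) * (1 - (1 - p)) = p - p * z * p.
Proof. by rewrite subKr mulrBl mul1r. Qed.

(** [1 - p * q * p] fixes [1 - p] on both sides, so both absorption conditions of [MP_corner] follow
    from [x * y * x = x], one of them through an adjoint. *)
Lemma MP_one_sub_pqp :
  MP_invertible star (1 - p * q * p) <-> MP_invertible star (p - p * q * p).
Proof.
have rP := projectorC p_proj.
have rx := compl_mul_one_sub (q * p); rewrite mulrA in rx.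
have xr : (1 - p * q * p) * (1 - p) = 1 - p.
  by rewrite mulrBl mul1r mulrBr mulr1 -(mulrA _ p) pp subrr subr0.
have corner := one_sub_mul_corner (q * p).
rewrite mulrA -(mulrA _ p) pp in corner.
split=> [[y yP]|[c cP]]; last first.
  apply: (MP_triangular (c := c) rP rx); rewrite corner //.
  by rewrite [(_ - 1) * _]mulrBl mul1r xr subrr !mulr0.
have [xyx yxy sxy syx] := yP.
have xyr : (1 - p * q * p) * y * (1 - p) = 1 - p by rewrite -[in LHS]xr mulrA xyx xr.
have ryx : (1 - p) * (y * (1 - p * q * p)) = 1 - p.
  by rewrite -[in LHS]rx -mulrA [X in _ * X]mulrA xyx rx.
have yxr : y * (1 - p * q * p) * (1 - p) = 1 - p.
  by case: rP => _ sr; rewrite -syx -[in LHS]sr -sM ryx sr.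
by exists (y * (1 - (1 - p))); rewrite -corner; apply: MP_corner.
Qed.

Lemma MP_one_sub_pq :
  star_cancellable star (p * (1 - q)) -> star_cancellable star (q * (1 - p)) ->
  MP_invertible star (1 - p * q) <-> MP_invertible star (p - p * q * p).
Proof.
move=> can_pq can_qp.
have rP := projectorC p_proj; have [rr sr] := rP; rewrite expr2 in rr.
have rx := compl_mul_one_sub q; have corner := one_sub_mul_corner q.
split=> [[y yP]|[c cP]]; last first.
  apply: (MP_triangular (c := c) rP rx); rewrite corner //.
  (* Since [p * (1 - p) = 0], the off-diagonal block has the left factor [p * (1 - q)], which
     [cancel_mul_star] shows to be fixed. *)
  have kE : (1 - p * q - 1) * (1 - p) = p * (1 - q) * (1 - p).
    rewrite addrAC subrr add0r [p * (1 - q)]mulrBr mulr1 [RHS]mulrBl.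
    by rewrite [p * (1 - p)]mulrBr mulr1 pp subrr add0r mulNr.
  rewrite kE -mul_star_projectors [LHS]mulrA cancel_mul_star //.
  by rewrite mul_star_projectors.
have [xyx yxy sxy syx] := yP.
have xyr : (1 - p * q) * y * (1 - p) = 1 - p.
  (* [n] is the projector onto the kernel of [1 - q * p] *)
  pose n := 1 - (1 - p * q) * y.
  have npq : n * (p * q) = n.
    apply/esym/subr0_eq; rewrite -{1}[n]mulr1 -mulrBr.
    by rewrite mulrBl mul1r xyx subrr.
  have nq : n * q = n by rewrite -npq -!mulrA qq.
  (* The product equals [n * (1 - p) * q = n * q - n * p * q = n - n]. Cancelling leaves
     [n * (1 - p) = 0], which is the claim. *)
  have /(proj2 (can_qp _)) : n * (q * (1 - p)) * star (q * (1 - p)) = 0.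
    rewrite sM sr sq -!mulrA (mulrA (1 - p)) rr mulrA nq.
    by rewrite [(1 - p) * q]mulrBl mul1r mulrBr nq npq subrr.
  by rewrite mulrA nq mulrBl mul1r => /subr0_eq.
have yxr : y * (1 - p * q) * (1 - p) = 1 - p.
  (* [m] is the projector onto the kernel of [1 - p * q] *)
  pose m := 1 - y * (1 - p * q).
  (* So the image of [m] lies in that of [p]; as [m] is self-adjoint, also [m * p = m]. *)
  have pqm : p * q * m = m.
    apply/esym/subr0_eq; rewrite -{1}[m]mul1r -mulrBl.
    by rewrite mulrBr mulr1 mulrA xyx subrr.
  have sm : star m = m by rewrite starB star1 syx.
  have := congr1 star pqm; rewrite !sM sp sq sm => mqp.
  have mp : m * p = m by rewrite -mqp -!mulrA pp.
  have : m * (1 - p) = 0 by rewrite mulrBr mulr1 mp subrr.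
  by rewrite mulrBl mul1r => /subr0_eq.
by exists (y * (1 - (1 - p))); rewrite -corner; apply: MP_corner.
Qed.

End Projectors.

End StarRing.

Theorem proposition3p2 (R : pzRingType) (star : R -> R)
    (star_inv : star_ring_involution star)
    (p q : R) (p_proj : projector star p) (q_proj : projector star q)
    (pq_canc : star_cancellable star (p * (1 - q)))
    (qp_canc : star_cancellable star (q * (1 - p))) :
  [<-> MP_invertible star (1 - p * q);
       MP_invertible star (1 - p * q * p);
       MP_invertible star (p - p * q * p);
       MP_invertible star (p - p * q);
       MP_invertible star (p - q * p);
       MP_invertible star (1 - q * p);
       MP_invertible star (1 - q * p * q);
       MP_invertible star (q - q * p * q);
       MP_invertible star (q - q * p);
       MP_invertible star (q - p * q)].
Proof.
(* Conditions (1), (2), (4) are tied to (3), and (6), (7), (9) to (8) by exchanging [p] and [q].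
   Adjoints add (5) and (10) and join the two groups through (1) and (6). *)
have iff13 := MP_one_sub_pq star_inv p_proj q_proj pq_canc qp_canc.
have iff23 := MP_one_sub_pqp star_inv q p_proj.
have iff43 := MP_sub_mul_corner star_inv p_proj q_proj pq_canc.
have iff68 := MP_one_sub_pq star_inv q_proj p_proj qp_canc pq_canc.
have iff78 := MP_one_sub_pqp star_inv p q_proj.
have iff98 := MP_sub_mul_corner star_inv q_proj p_proj qp_canc.
have star_sub a b : projector star a -> projector star b ->
    MP_invertible star (a - a * b) <-> MP_invertible star (a - b * a).
  move=> aP bP; have sE := star_sub_mul star_inv aP bP.
  split=> /(MP_star star_inv); first by rewrite sE.
  by rewrite -sE (starK star_inv).
have iff45 := star_sub p q p_proj q_proj.
have iff910 := star_sub q p q_proj p_proj.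
have iff16 : MP_invertible star (1 - p * q) <-> MP_invertible star (1 - q * p).
  have sE : star (1 - p * q) = 1 - q * p.
    case: p_proj q_proj => _ sp [_ sq].
    by rewrite starB // star1 // (starM star_inv) sp sq.
  split=> /(MP_star star_inv); first by rewrite sE.
  by rewrite -sE (starK star_inv).
by tfae; tauto.
Qed.
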